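(* Let $T$ be a finite tree and let $H$ be a finite bipartite graph having Sidorenko's property. Then the Cartesian product $T\,\square\, H$ has Sidorenko's property.
   Context: All graphs are finite and simple. For graphs $H,G$, $\mathrm{Hom}(H,G)$ is the set of homomorphisms $V(H)\to V(G)$, and $t_H(G)=|\mathrm{Hom}(H,G)|/|V(G)|^{|V(H)|}$. A bipartite graph $H$ has Sidorenko's property if $t_H(G)\ge t_{K_2}(G)^{|E(H)|}$ for all graphs $G$. The Cartesian product $H_1\,\square\,H_2$ is the graph on $V(H_1)\times V(H_2)$ in which $(u_1,u_2)$ and $(v_1,v_2)$ are adjacent iff either $u_1v_1\in E(H_1)$ and $u_2=v_2$, or $u_2v_2\in E(H_2)$ and $u_1=v_1$. *)

(* Defs.v *)
From mathcomp Require Import all_boot all_order all_algebra.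

Set Implicit Arguments.
Unset Strict Implicit.
Unset Printing Implicit Defensive.

Import Order.TTheory GRing.Theory Num.Theory.
Local Open Scope ring_scope.

Record sgraph := SGraph {
  vertex :> finType;
  adj : rel vertex;
  adj_sym : symmetric adj;
  adj_irrefl : irreflexive adj
}.

Definition edges (H : sgraph) : {set {set H}} :=
  [set [set p.1; p.2] | p : H * H & adj p.1 p.2].

Definition homs (H G : sgraph) : {set {ffun H -> G}} :=
  [set f : {ffun H -> G} | [forall x, forall y, adj x y ==> adj (f x) (f y)]].

Definition hom_density (H G : sgraph) : rat :=
  #|homs H G|%:R / (#|G| ^ #|H|)%N%:R.

Definition K2_adj : rel 'I_2 := fun x y => x != y.

Lemma K2_adj_sym : symmetric K2_adj.
Proof. by move=> x y; rewrite /K2_adj eq_sym. Qed.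

Lemma K2_adj_irrefl : irreflexive K2_adj.
Proof. by move=> x; rewrite /K2_adj eqxx. Qed.

Definition K2 : sgraph := SGraph K2_adj_sym K2_adj_irrefl.

Definition bipartite (H : sgraph) : Prop :=
  exists c : H -> bool, forall x y : H, adj x y -> c x != c y.

(* The density of H in G is only meaningful for G with at least one vertex. *)
Definition sidorenko (H : sgraph) : Prop :=
  bipartite H /\
  forall G : sgraph, (0 < #|G|)%N ->
    hom_density K2 G ^+ #|edges H| <= hom_density H G.

Definition connected_graph (T : sgraph) : Prop :=
  forall x y : T, connect (@adj T) x y.

(* In a loopless graph, [ucycle adj] also accepts the empty sequence and, by
   traversing an edge back and forth, sequences of length 2; a genuine graph
   cycle has at least 3 vertices. *)
Definition acyclic_graph (T : sgraph) : Prop :=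
  forall c : seq T, (2 < size c)%N -> ~ ucycle (@adj T) c.

Definition is_tree (T : sgraph) : Prop :=
  [/\ (0 < #|T|)%N, connected_graph T & acyclic_graph T].

Definition cart_adj (H1 H2 : sgraph) : rel (H1 * H2) := fun u v =>
  (adj u.1 v.1 && (u.2 == v.2)) || (adj u.2 v.2 && (u.1 == v.1)).

Lemma cart_adj_sym (H1 H2 : sgraph) : symmetric (@cart_adj H1 H2).
Proof.
move=> u v; rewrite /cart_adj (adj_sym u.1) (adj_sym u.2).
by rewrite (eq_sym u.1) (eq_sym u.2).
Qed.

Lemma cart_adj_irrefl (H1 H2 : sgraph) : irreflexive (@cart_adj H1 H2).
Proof. by move=> u; rewrite /cart_adj !adj_irrefl. Qed.

Definition cart_prod (H1 H2 : sgraph) : sgraph :=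
  SGraph (@cart_adj_sym H1 H2) (@cart_adj_irrefl H1 H2).

(* Main.v *)
(** Proof idea.  First, nearly regular targets.  Let g have n vertices, S arcs
    and maximum degree at most L S / n.  Homomorphisms T [] H -> g are
    homomorphisms from H to the graph Lambda whose vertices are the
    homomorphisms T -> g, two of them being adjacent when they are pointwise
    adjacent.  Lambda has M = hom(T, g) vertices and E = hom(T [] K2, g) arcs.
    Near-regularity gives M <= n (L S / n)^e(T).  The lower bound
    hom(T, g) >= n (S / 4n)^e(T) holds for every graph: prune it to minimum degree
    S / 4n while keeping half of its arcs, and embed T greedily, starting from an
    arc.  Applied to the graph whose vertices are the arcs of g and whose arcs are
    the 4-cycles of g, it also bounds E from below.  Sidorenko's property of H
    for Lambda then gives the required bound on hom(T [] H, g), up to a constant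
    and a power of L.

    A general target G is replaced by a large tensor power.  Let A and B be the
    two dyadic degree classes spanning the most arcs.  On A x B, make (x, y)
    adjacent to (x', y') when x y' and x' y are edges; this graph is nearly
    regular, with L polylogarithmic, and since T [] H is bipartite it receives at
    most hom(T [] H, -)^2 homomorphisms.  The polylogarithmic losses in the k-th
    tensor power are polynomial in k, hence disappear as k tends to infinity. *)

Require Import Defs.
From mathcomp Require Import all_boot all_order all_algebra.
From mathcomp Require Import ring zify.

Set Implicit Arguments.
Unset Strict Implicit.
Unset Printing Implicit Defensive.

Import Order.TTheory GRing.Theory Num.Theory.

(** * Counting homomorphisms, arcs and edges *)

Lemma leq_card_inj_in (aT rT : finType) (f : aT -> rT) (A : {pred aT})
    (B : {pred rT}) :
  {in A &, injective f} -> (forall x, x \in A -> f x \in B) -> #|A| <= #|B|.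
Proof.
move=> f_inj fAB; rewrite -(card_in_imset f_inj).
by apply/subset_leq_card/subsetP => _ /imsetP[x Ax ->]; apply: fAB.
Qed.

Lemma sum_nat_bool (I : finType) (P : pred I) : \sum_i (P i : nat) = #|P|.
Proof.
rewrite -sum1_card [RHS]big_mkcond; apply: eq_bigr => i _.
by case: ifP; rewrite unfold_in => ->.
Qed.

(* Targets of homomorphisms are arbitrary relations, loops allowed: loops
   appear when passing to auxiliary graphs. *)
Definition is_hom (H : sgraph) (V : finType) (g : rel V) (f : {ffun H -> V}) :=
  [forall x, forall y, adj x y ==> g (f x) (f y)].

Definition nhom (H : sgraph) (V : finType) (g : rel V) := #|is_hom (H := H) g|.

Definition narcs (V : finType) (g : rel V) := #|[pred p : V * V | g p.1 p.2]|.

Definition deg (V : finType) (g : rel V) (x : V) := #|g x|.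

Lemma is_homP (H : sgraph) (V : finType) (g : rel V) (f : {ffun H -> V}) :
  reflect (forall x y, adj x y -> g (f x) (f y)) (is_hom g f).
Proof.
apply: (iffP forallP) => [h x y xy | h x].
  by move/forallP: (h x) => /(_ y)/implyP; apply.
by apply/forallP => y; apply/implyP; apply: h.
Qed.

Lemma narcs_deg (V : finType) (g : rel V) : narcs g = \sum_x deg g x.
Proof.
rewrite /narcs -sum_nat_bool -(pair_bigA _ (fun x y => g x y : nat)) /=.
by apply: eq_bigr => x _; rewrite sum_nat_bool.
Qed.

Lemma narcs_edges (H : sgraph) : narcs (@adj H) = 2 * #|edges H|.
Proof.
rewrite /narcs -[LHS]sum1_card.
rewrite (partition_big (fun p : H * H => [set p.1; p.2]) (fun e => e \in edges H)) /=;
  last first.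
  by move=> p adjp; apply/imsetP; exists p; rewrite ?inE.
rewrite mulnC -sum_nat_const; apply: eq_bigr => _ /imsetP[[x y] /= + ->].
rewrite inE /= => xy.
have neq_xy : x != y by apply: contraTneq xy => ->; rewrite adj_irrefl.
rewrite (eq_bigl (mem [set (x, y); (y, x)])) ?sum1_card ?cards2 => [|[a b]].
  by rewrite xpair_eqE negb_and neq_xy.
rewrite !inE /= !xpair_eqE; apply/andP/orP => [[ab /eqP eq_ab]|].
  have : x \in [set a; b] by rewrite eq_ab !inE eqxx.
  have : y \in [set a; b] by rewrite eq_ab !inE eqxx orbT.
  have neq_ab : a != b by apply: contraTneq ab => ->; rewrite adj_irrefl.
  rewrite !inE => /orP[] /eqP ya /orP[] /eqP xa; subst.
  - by rewrite eqxx in neq_xy.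
  - by right; rewrite !eqxx.
  - by left; rewrite !eqxx.
  - by rewrite eqxx in neq_xy.
by case=> /andP[/eqP-> /eqP->]; split=> //; [rewrite adj_sym | rewrite setUC].
Qed.

Lemma nhom_K2 (G : sgraph) : nhom K2 (@adj G) = narcs (@adj G).
Proof.
pose toPair (f : {ffun K2 -> G}) := (f ord0, f (lift ord0 ord0)).
pose ofPair (p : G * G) : {ffun K2 -> G} :=
  [ffun i : 'I_2 => if i == ord0 then p.1 else p.2].
apply/eqP; rewrite eqn_leq; apply/andP; split.
  apply: (@leq_card_inj_in _ _ toPair) => [f1 f2 _ _ [e0 e1] | f /is_homP h].
    apply/ffunP => i; case: (unliftP ord0 i) => [j ->|->] //.
    by rewrite (ord1 j).
  by rewrite inE /=; apply: h.
apply: (@leq_card_inj_in _ _ ofPair) => [[a b] [c d] _ _ /ffunP e | [a b] ab].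
  have := e (lift ord0 ord0); have := e ord0; rewrite !ffunE /=.
  by move=> -> ->.
apply/is_homP => i j; rewrite /= /K2_adj !ffunE.
case: (unliftP ord0 i) => [i' ->|->]; case: (unliftP ord0 j) => [j' ->|->] //=;
  rewrite ?(ord1 i') ?(ord1 j') ?eqxx // => _.
by rewrite adj_sym.
Qed.

(** Clearing the positive denominators, where [K2] contributes arcs over [#|G| ^ 2], moves the whole
    argument from the rationals to [nat]. *)
Lemma hom_density_ineqP (H G : sgraph) : 0 < #|G| ->
  (hom_density K2 G ^+ #|edges H| <= hom_density H G)%R =
  (narcs (@adj G) ^ #|edges H| * #|G| ^ #|H|
     <= nhom H (@adj G) * #|G| ^ (2 * #|edges H|)).
Proof.
move=> G0; rewrite /hom_density.
have homsE (K : sgraph) : #|homs K G| = nhom K (@adj G).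
  by apply: eq_card => f; rewrite inE.
rewrite !homsE nhom_K2 card_ord.
rewrite expr_div_n ler_pdivrMr; last by rewrite exprn_gt0 // ltr0n expn_gt0 G0.
rewrite mulrAC ler_pdivlMr; last by rewrite ltr0n expn_gt0 G0.
by rewrite -!natrX -!natrM ler_nat -expnM.
Qed.

Lemma narcs_cart (H1 H2 : sgraph) : narcs (@cart_adj H1 H2) =
  narcs (@adj H1) * #|H2| + #|H1| * narcs (@adj H2).
Proof.
rewrite !narcs_deg big_distrl /= -[X in _ + X]sum_nat_const.
rewrite -big_split /= -(pair_bigA _ (fun x y => deg (@cart_adj H1 H2) (x, y))) /=.
apply: eq_bigr => x _; rewrite mulnC -sum_nat_const -big_split /=.
apply: eq_bigr => y _; rewrite /deg -!sum_nat_bool.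
rewrite -(pair_bigA _ (fun a b => @cart_adj H1 H2 (x, y) (a, b) : nat)) /=.
transitivity (\sum_(a : H1) \sum_(b : H2)
   ((adj x a && (y == b) : nat) + (adj y b && (x == a) : nat))).
  apply: eq_bigr => a _; apply: eq_bigr => b _; rewrite /cart_adj /=.
  case: (eqVneq y b) => [<-|_]; last by rewrite andbF.
  by rewrite adj_irrefl orbF addn0.
under eq_bigr do rewrite big_split /=.
rewrite big_split /=; congr (_ + _).
  apply: eq_bigr => a _; rewrite (bigD1 y) //= eqxx andbT big1 ?addn0 // => b.
  by rewrite eq_sym => /negPf->; rewrite andbF.
rewrite exchange_big; apply: eq_bigr => b _ /=.
rewrite (bigD1 x) //= eqxx andbT big1 ?addn0 // => a.
by rewrite eq_sym => /negPf->; rewrite andbF.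
Qed.

Lemma card_edges_cart (H1 H2 : sgraph) : #|edges (cart_prod H1 H2)| =
  #|edges H1| * #|H2| + #|H1| * #|edges H2|.
Proof.
have := narcs_cart H1 H2; rewrite !narcs_edges.
have -> : narcs (@cart_adj H1 H2) = 2 * #|edges (cart_prod H1 H2)|.
  exact: (@narcs_edges (cart_prod H1 H2)).
lia.
Qed.

(** * Trees grown leaf by leaf *)

(** Each vertex put in front has exactly one neighbour among the earlier ones, so an induction on
    [grown] strips one leaf at a time. *)
Inductive grown (T : sgraph) : seq T -> Prop :=
| Grown1 x : grown [:: x]
| GrownS x y s : grown s -> x \notin s -> y \in s ->
    (forall z, z \in s -> adj x z = (z == y)) -> grown (x :: s).

Lemma grown_uniq (T : sgraph) (s : seq T) : grown s -> uniq s.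
Proof. by elim=> //= x y {}s _ -> xs _ _; rewrite xs. Qed.

Lemma grown_connect (T : sgraph) (s : seq T) : grown s ->
  {in s &, forall u v, connect [rel a b | [&& a \in s, b \in s & adj a b]] u v}.
Proof.
elim=> [x u v | x y {}s _ IH xs ys adjx u v].
  by rewrite !inE => /eqP-> /eqP->; apply: connect0.
set e := [rel a b | _].
have e_sym : connect_sym e.
  by apply: sym_connect_sym => a b; rewrite /e /= adj_sym andbCA.
have sub_s a b : a \in s -> b \in s -> connect e a b.
  move=> a_s b_s; apply: connect_sub (IH a b a_s b_s) => c d /and3P[c_s d_s cd].
  by apply: connect1; rewrite /e /= !inE c_s d_s cd !orbT.
have x_to a : a \in s -> connect e x a.
  move=> a_s; apply: connect_trans (sub_s y a ys a_s); apply: connect1.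
  by rewrite /e /= !inE eqxx ys orbT adjx /=.
rewrite !inE => /orP[/eqP->|u_s] /orP[/eqP->|v_s]; first exact: connect0.
- exact: x_to.
- by rewrite e_sym; apply: x_to.
- exact: sub_s.
Qed.

(** Connectivity provides an edge from some [y] in [s] to some [x] outside. A second neighbour [u]
    of [x] in [s] would close a cycle through [x], [y] and a path from [y] to [u] inside [s]. *)
Lemma grown_extend (T : sgraph) (s : seq T) (z : T) :
  connected_graph T -> acyclic_graph T -> grown s -> z \notin s ->
  exists x, grown (x :: s).
Proof.
move=> conT acT gs zs.
have [r rs] : exists r, r \in s.
  by case: gs => [x | x ? ? _ _ _ _]; exists x; rewrite inE eqxx.
have [y [x [ys xs yx]]] : exists y x, [/\ y \in s, x \notin s & adj y x].
  have [p] := connectP (conT r z).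
  elim: p r rs => [|b p IH] r rs /=; first by move=> _ e; rewrite e rs in zs.
  case/andP=> rb bp lst; case: (boolP (b \in s)) => bs.
    exact: IH bs bp lst.
  by exists r, b.
exists x; apply: (@GrownS _ x y) => // u us.
apply/idP/eqP => [xu | ->]; last by rewrite adj_sym.
apply/eqP/negPn/negP => neq_uy.
(* The path is shortened to a simple one, since [ucycle] asks for distinct vertices. *)
case/connectP: (grown_connect gs ys us) => p0 /shortenP[p yp uniq_p _] lst {p0}.
have in_s : {subset p <= s}.
  elim: p (y) yp {uniq_p lst} => // b p IH a /= /andP[/and3P[_ bs _] bp] c.
  by rewrite inE => /orP[/eqP-> //|]; apply: IH bp c.
apply: (acT [:: x, y & p]).
  by case: (p) lst => [/= e|//]; rewrite e eqxx in neq_uy.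
have yp' : path (@adj T) y p.
  by apply: sub_path yp => a b /and3P[].
apply/andP; split; rewrite /= ?rcons_path ?yp' -?lst -?(adj_sym x) ?xu
  ?(adj_sym x) ?yx //.
rewrite inE negb_or -[X in _ && X]/(uniq (y :: p)) uniq_p andbT.
apply/andP; split; first by apply: contraNneq xs => ->.
by apply: contra xs => /in_s.
Qed.

Lemma tree_grown (T : sgraph) :
  is_tree T -> exists2 s : seq T, grown s & forall x, x \in s.
Proof.
case=> /card_gt0P[r _] conT acT.
suff H n (s : seq T) : grown s -> #|T| <= n + size s ->
    exists2 s' : seq T, grown s' & forall x, x \in s'.
  by apply: (H #|T| [:: r]); [apply: Grown1 | rewrite leq_addr].
elim: n s => [|n IH] s gs le_n.
  exists s => // x; have : #|s| = #|T|.
    apply/eqP; rewrite eqn_leq max_card /= (card_uniqP _) ?grown_uniq //.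
  by move=> /subset_cardP/(_ (subset_predT _)) ->.
case: (boolP [forall x, x \in s]) => [/forallP all_s | ]; first by exists s.
rewrite negb_forall => /existsP[z zs].
have [x gx] := grown_extend conT acT gs zs.
by apply: IH gx _; rewrite /= addnS -addSn.
Qed.

Lemma grown_size_gt0 (T : sgraph) (s : seq T) : grown s -> 0 < size s.
Proof. by case. Qed.

Lemma size_full_seq (T : finType) (s : seq T) :
  uniq s -> (forall x, x \in s) -> size s = #|T|.
Proof. by move=> /card_uniqP <- all_s; apply: eq_card => x; rewrite all_s. Qed.

Lemma grown_arcs (T : sgraph) (s : seq T) : grown s ->
  \sum_(x <- s) \sum_(y <- s) (adj x y : nat) = 2 * (size s).-1.
Proof.
elim=> [x | x y {}s gs IH xs ys adjx]; first by rewrite !big_seq1 adj_irrefl.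
have sum_x : \sum_(a <- s) (adj x a : nat) = 1.
  rewrite (bigD1_seq y) ?grown_uniq //= adjx // eqxx big1_seq ?addn0 // => a.
  by case/andP=> /negPf neq a_s; rewrite adjx // neq.
rewrite big_cons big_cons adj_irrefl sum_x.
under eq_bigr do rewrite big_cons.
rewrite big_split /= IH.
under eq_bigr do rewrite adj_sym.
by rewrite sum_x; have := grown_size_gt0 gs; case: (size s) => //= n _; lia.
Qed.

Lemma tree_edges (T : sgraph) : is_tree T -> #|T| = #|edges T|.+1.
Proof.
move=> treeT; have [s gs all_s] := tree_grown treeT.
have size_s := size_full_seq (grown_uniq gs) all_s.
have sum_s (F : T -> nat) : \sum_(x <- s) F x = \sum_x F x.
  by rewrite big_uniq ?grown_uniq //; apply: eq_bigl => x; rewrite all_s.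
have := grown_arcs gs; rewrite sum_s.
under eq_bigr do rewrite sum_s sum_nat_bool.
rewrite -[LHS]/(\sum_x deg (@adj T) x) -narcs_deg narcs_edges size_s.
by have := grown_size_gt0 gs; rewrite size_s; lia.
Qed.

Lemma tree_bipartite (T : sgraph) : is_tree T -> bipartite T.
Proof.
move=> treeT; have [s gs all_s] := tree_grown treeT.
suff [c hc] : exists c : T -> bool, {in s &, forall a b, adj a b -> c a != c b}.
  by exists c => a b; apply: hc.
elim: gs => [x | x y {all_s}s gs [c hc] xs ys adjx].
  by exists (fun=> true) => a b; rewrite !inE => /eqP-> /eqP->; rewrite adj_irrefl.
exists (fun z => if z == x then ~~ c y else c z) => a b.
have neqx u : u \in s -> (u == x) = false.
  by move=> us; apply/negP => /eqP ux; rewrite -ux us in xs.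
rewrite !inE => /orP[/eqP->|a_s] /orP[/eqP->|b_s]; rewrite ?eqxx ?neqx //.
- by rewrite adj_irrefl.
- by rewrite adjx // => /eqP->; case: (c y).
- by rewrite adj_sym adjx // => /eqP->; case: (c y).
- exact: hc.
Qed.

(** * Homomorphism counts of trees under degree conditions *)

Section TreeHomomorphisms.

Variables (T : sgraph) (V : finType) (g : rel V).
Hypothesis g_sym : symmetric g.
Local Notation n := #|V|.

Definition upd (f : {ffun T -> V}) (x : T) (w : V) : {ffun T -> V} :=
  [ffun z => if z == x then w else f z].

(** Exchanging [w] with the value [f x] is an involution on the pairs [(f, w)]. *)
Lemma sum_upd (x : T) (F : {ffun T -> V} -> nat) :
  \sum_f \sum_w F (upd f x w) = n * \sum_f F f.
Proof.
rewrite pair_bigA /=.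
pose swap (q : {ffun T -> V} * V) := (upd q.1 x q.2, q.1 x).
have swapK : involutive swap.
  case=> f w; congr pair; rewrite /= ?ffunE ?eqxx //.
  by apply/ffunP => z; rewrite !ffunE; case: eqP => [->|].
rewrite (reindex_inj (inv_inj swapK)) /= big_distrr /=.
rewrite -(pair_bigA _ (fun f w => F (upd (upd f x w) x (f x)))) /=.
apply: eq_bigr => f _; rewrite -sum_nat_const; apply: eq_bigr => w _.
by congr F; apply/ffunP => z; rewrite !ffunE; case: eqP => [->|].
Qed.

Lemma sum_leaf (P Q : pred {ffun T -> V}) (x y : T) (F : {ffun T -> V} -> nat) :
  y != x -> (forall f w, P (upd f x w) = P f) ->
  (forall f, Q f = P f && g (f y) (f x)) ->
  n * \sum_f Q f * F f = \sum_f P f * \sum_w g (f y) w * F (upd f x w).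
Proof.
move=> neq_yx Pupd Qdef; rewrite -(sum_upd x); apply: eq_bigr => f _.
rewrite big_distrr; apply: eq_bigr => w _ /=.
by rewrite Qdef Pupd !ffunE eqxx (negPf neq_yx) mulnA mulnb.
Qed.

(** The maps stay total on [T]: values outside [s] are free and each contributes a factor [n], so
    all stages of the induction live on one type. *)
Definition phom (s : seq T) (f : {ffun T -> V}) :=
  all (fun x => all (fun y => adj x y ==> g (f x) (f y)) s) s.

Lemma phomP (s : seq T) (f : {ffun T -> V}) :
  reflect {in s &, forall x y, adj x y -> g (f x) (f y)} (phom s f).
Proof.
apply: (iffP allP) => [h x y xs ys | h x xs].
  by apply/implyP; apply: (allP (h x xs)).
by apply/allP => y ys; apply/implyP; apply: h.
Qed.

Lemma phom_full (s : seq T) : (forall x, x \in s) -> phom s =1 is_hom g.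
Proof.
move=> all_s f; apply/phomP/is_homP => h x y; first exact: h.
by move=> _ _; apply: h.
Qed.

Lemma phom_upd (s : seq T) (x : T) f w : x \notin s ->
  phom s (upd f x w) = phom s f.
Proof.
move=> xs; have E z : z \in s -> upd f x w z = f z.
  by move=> zs; rewrite ffunE; case: eqP => // zx; rewrite -zx zs in xs.
by apply/phomP/phomP => h a b a_s b_s ab; have := h a b a_s b_s ab; rewrite !E.
Qed.

Lemma phom_leaf (s : seq T) (x y : T) f :
  y \in s -> (forall z, z \in s -> adj x z = (z == y)) ->
  phom (x :: s) f = phom s f && g (f y) (f x).
Proof.
move=> ys adjx; apply/phomP/andP => [h | [/phomP h gyx] a b].
  split; first by apply/phomP => a b a_s b_s; apply: h; rewrite inE ?a_s ?b_s orbT.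
  by apply: h; rewrite ?inE ?eqxx ?ys ?orbT // adj_sym adjx.
rewrite !inE => /orP[/eqP->|a_s] /orP[/eqP->|b_s]; first by rewrite adj_irrefl.
- by rewrite adjx // => /eqP->; rewrite g_sym.
- by rewrite adj_sym adjx // => /eqP->.
- exact: h.
Qed.

Lemma sum_phom_leaf (s : seq T) (x y : T) :
  x \notin s -> y \in s -> (forall z, z \in s -> adj x z = (z == y)) ->
  n * \sum_f (phom (x :: s) f : nat) = \sum_f phom s f * deg g (f y).
Proof.
move=> xs ys adjx; have neq_yx : y != x by apply: contraNneq xs => <-.
have := sum_leaf (fun=> 1) neq_yx (fun f w => phom_upd f w xs)
  (fun f => phom_leaf f ys adjx).
under eq_bigr do rewrite muln1.
move=> ->; apply: eq_bigr => f _; under eq_bigr do rewrite muln1.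
by rewrite sum_nat_bool.
Qed.

(** A new leaf has at most [D] possible images instead of [n] free ones, so each leaf multiplies the
    count by at most [D / n]. *)
Lemma phom_upper (D : nat) (s : seq T) : (forall x, deg g x <= D) -> grown s ->
  n ^ (size s).-1 * \sum_f (phom s f : nat) <= D ^ (size s).-1 * n ^ #|T|.
Proof.
move=> degD; elim=> [x | x y {}s gs IH xs ys adjx].
  rewrite /= !mul1n -card_ffun -sum1_card; apply: leq_sum => f _.
  exact: leq_b1.
have step : n * \sum_f (phom (x :: s) f : nat) <= D * \sum_f (phom s f : nat).
  rewrite (sum_phom_leaf xs ys adjx) big_distrr /=.
  by apply: leq_sum => f _; rewrite mulnC leq_mul.
move: IH step; have := grown_size_gt0 gs.
rewrite -[size (x :: s)]/(size s).+1.
case: (size s) => // k _; rewrite !succnK !expnS => IH step.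
rewrite [n * _]mulnC -mulnA (leq_trans (leq_mul (leqnn _) step)) //.
by rewrite mulnCA -mulnA leq_mul.
Qed.

(** Positive degrees at the images make the minimum degree hypothesis, silent about isolated
    vertices, applicable there. *)
Definition zhom (s : seq T) (f : {ffun T -> V}) :=
  phom s f && all (fun x => 0 < deg g (f x)) s.

Lemma deg_gt0 (x y : V) : g x y -> 0 < deg g x.
Proof. by move=> xy; apply/card_gt0P; exists y. Qed.

(* The weight [deg g (f z)] makes the induction start from an arc rather than
   from a vertex. *)
Lemma zhom_lower (S c : nat) (s : seq T) (z : T) :
  (forall x, 0 < deg g x -> S <= c * deg g x) -> grown s -> z \in s ->
  n ^ #|T| * narcs g * S ^ (size s).-1 <=
  (\sum_f zhom s f * deg g (f z)) * n * (c * n) ^ (size s).-1.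
Proof.
move=> degS gs; elim: gs z => [x | x y {}s gs IH xs ys adjx] z zs.
  rewrite /= !muln1 [_ * n]mulnC -(sum_upd x) -card_ffun -sum_nat_const.
  apply: leq_sum => f _; rewrite narcs_deg; apply: leq_sum => w _.
  move: zs; rewrite inE => /eqP->.
  have -> : zhom [:: x] (upd f x w) = (0 < deg g w).
    by rewrite /zhom /phom /= !ffunE eqxx adj_irrefl !andbT.
  by rewrite !ffunE eqxx; case: (deg g w) => //= m; rewrite mul1n.
have neq_yx : y != x by apply: contraNneq xs => <-.
have zleaf f : zhom (x :: s) f = zhom s f && g (f y) (f x).
  rewrite /zhom (phom_leaf f ys adjx) /= andbAC -!andbA; congr andb.
  rewrite andbCA; case gyx: (g _ _); rewrite ?andbF // !andbT.
  by rewrite (@deg_gt0 (f x) (f y)) ?andbT // g_sym.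
have zupd f w : zhom s (upd f x w) = zhom s f.
  rewrite /zhom phom_upd //; congr andb; apply: eq_in_all => u us.
  by rewrite ffunE; case: eqP => // ux; rewrite -ux us in xs.
(* If the weight sits at the leaf [x], each image of [x] has degree at least [S / c], and counting
   these images leaves the weight [deg g (f y)] at the parent. Otherwise the weight stays at [z] and
   the leaf has at least [S / c] images. *)
pose z' := if z == x then y else z.
have z's : z' \in s.
  by rewrite /z'; move: zs; rewrite inE; case: eqP.
have step : S * (\sum_f zhom s f * deg g (f z')) <=
    c * (n * \sum_f zhom (x :: s) f * deg g (f z)).
  rewrite (sum_leaf (fun f => deg g (f z)) neq_yx zupd zleaf) !big_distrr /=.
  apply: leq_sum => f _; rewrite mulnCA [leqRHS]mulnCA.
  case: (boolP (zhom s f)) => // /andP[_ /allP posf]; rewrite !mul1n.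
  rewrite /z'; case: (eqVneq z x) => [->|neq_zx].
    rewrite big_distrr /deg -sum_nat_bool big_distrr /=; apply: leq_sum => w _.
    rewrite ffunE eqxx; case gyw: (g _ _); rewrite ?muln0 // muln1 mul1n.
    by apply: degS; apply: (@deg_gt0 w (f y)); rewrite g_sym.
  under eq_bigr do rewrite ffunE (negPf neq_zx).
  by rewrite -big_distrl sum_nat_bool mulnA leq_mul // degS ?posf.
move: (IH z' z's) step; have := grown_size_gt0 gs.
rewrite -[size (x :: s)]/(size s).+1.
case: (size s) => // k _; rewrite !succnK !expnS.
set A := \sum_f _; set B := \sum_f _ => IHz step.
rewrite mulnCA (leq_trans (leq_mul (leqnn S) IHz)) //.
rewrite !mulnA in step *; have -> : B * n * c * n = c * n * B * n by ring.
by apply: leq_mul => //; apply: leq_mul.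
Qed.

Lemma nhom_sum : nhom T g = \sum_(f : {ffun T -> V}) (is_hom g f : nat).
Proof. by rewrite sum_nat_bool. Qed.

Lemma tree_hom_upper (D : nat) : is_tree T -> (forall x, deg g x <= D) ->
  n ^ #|edges T| * nhom T g <= D ^ #|edges T| * n ^ #|T|.
Proof.
move=> treeT degD; have [s gs all_s] := tree_grown treeT.
have := phom_upper degD gs.
rewrite (size_full_seq (grown_uniq gs) all_s) (tree_edges treeT) /= nhom_sum.
by under eq_bigr do rewrite phom_full //.
Qed.

Lemma tree_hom_lower_mindeg (S c : nat) : is_tree T ->
  (forall x, 0 < deg g x -> S <= c * deg g x) -> 0 < #|edges T| ->
  n ^ #|T| * narcs g * S ^ #|edges T|.-1 <=
  nhom T g * n ^ 2 * (c * n) ^ #|edges T|.-1.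
Proof.
move=> treeT degS e0; have [s gs all_s] := tree_grown treeT.
move: (size_full_seq (grown_uniq gs) all_s); rewrite nhom_sum.
under eq_bigr do rewrite -(phom_full all_s).
case: gs {all_s} => [x | x y {}s gs xs ys adjx] /=.
  by rewrite (tree_edges treeT) => - [E]; rewrite -E in e0.
rewrite {1}(tree_edges treeT) => - [<-].
(* With the weight at the neighbour [y] of the last leaf, the weighted sum over [s] is at most [n]
   times the unweighted one over [x :: s]. *)
apply: leq_trans (zhom_lower degS gs ys) _; rewrite leq_mul //.
rewrite expnS expn1 [X in _ <= X]mulnC -mulnA [leqRHS]mulnC leq_mul //.
rewrite (sum_phom_leaf xs ys adjx); apply: leq_sum => f _.
rewrite leq_mul // /zhom.
by case: (phom s f) => //=; apply: leq_b1.
Qed.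

End TreeHomomorphisms.

(** * Pruning, and the lower bound for trees in arbitrary targets *)

Lemma leq_exp (a b k : nat) : a <= b -> a ^ k <= b ^ k.
Proof. by case: k => // k; rewrite leq_exp2r. Qed.

Definition restrict (V : finType) (g : rel V) (U : {set V}) : rel V :=
  fun x y => [&& x \in U, y \in U & g x y].

Lemma restrict_sym (V : finType) (g : rel V) (U : {set V}) :
  symmetric g -> symmetric (restrict g U).
Proof. by move=> g_sym x y; rewrite /restrict g_sym andbCA. Qed.

Lemma narcs_pairs (V : finType) (g : rel V) :
  narcs g = \sum_x \sum_y (g x y : nat).
Proof. by rewrite narcs_deg; apply: eq_bigr => x _; rewrite sum_nat_bool. Qed.

(** The lost arcs lie in the row or the column of [x]; a loop at [x] lies in both, hence an
    inequality. *)
Lemma narcs_restrictD1 (V : finType) (g : rel V) (U : {set V}) (x : V) :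
  symmetric g ->
  narcs (restrict g U) <= narcs (restrict g (U :\ x)) + 2 * deg (restrict g U) x.
Proof.
move=> g_sym; have := restrict_sym U g_sym; set h := restrict g U => h_sym.
have row : \sum_a \sum_b (a == x) * h x b = deg h x.
  under eq_bigr do rewrite -big_distrr /= sum_nat_bool.
  rewrite (bigD1 x) //= eqxx mul1n big1 ?addn0 // => a /negPf.
  by move=> ->.
have col : \sum_a \sum_b (b == x) * h x a = deg h x.
  by rewrite exchange_big /=.
rewrite mul2n -addnn -{1}row -col !narcs_pairs -!big_split /=.
apply: leq_sum => a _; rewrite -!big_split /=; apply: leq_sum => b _.
rewrite /restrict !in_setD1 -/(restrict g U a b) -/(restrict g U x b).
case: (eqVneq a x) => [->|neq_a] /=; first by rewrite mul1n add0n leq_addr.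
case: (eqVneq b x) => [->|neq_b] /=; last by rewrite !mul0n !addn0.
by rewrite mul1n mul0n andbF !add0n -/(h a x) h_sym.
Qed.

(* The set maximising (arcs inside U) - |U| S / 2n. *)
Lemma dense_restriction (V : finType) (g : rel V) : symmetric g -> 0 < #|V| ->
  exists U : {set V}, narcs g <= 2 * narcs (restrict g U) /\
    forall x, 0 < deg (restrict g U) x ->
      narcs g <= 4 * #|V| * deg (restrict g U) x.
Proof.
move=> g_sym n0; set S := narcs g; set n := #|V|.
pose w (U : {set V}) := 2 * n * narcs (restrict g U) + S * #|~: U|.
have [U _ Umax] := @arg_maxnP _ [set: V] predT w isT.
exists U; split.
  have := Umax setT isT; rewrite /w /= setCT cards0 muln0 addn0.
  have -> : narcs (restrict g setT) = S.
    by apply: eq_card => p; rewrite !inE /restrict !inE.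
  have : #|~: U| <= n by apply: max_card.
  move: (#|~: U|) (narcs _) => c R cn; rewrite -/n in n0; nia.
(* Deleting [x] adds [S] to the second term of [w] and costs the first at most [4 n] times the
   degree of [x]; maximality compares the two. *)
move=> x /card_gt0P[y]; rewrite unfold_in => /and3P[xU _ _].
have := Umax (U :\ x) isT; rewrite /w /=.
have -> : #|~: (U :\ x)| = #|~: U|.+1.
  have -> : ~: (U :\ x) = x |: ~: U.
    by apply/setP => z; rewrite !inE; case: eqP.
  by rewrite cardsU1 inE xU.
have := narcs_restrictD1 U x g_sym.
move: (#|~: U|) (narcs (restrict g U)) (narcs _) (deg _ _) => c R R' d; nia.
Qed.

Lemma nhom_sub (H : sgraph) (V : finType) (g g' : rel V) :
  subrel g g' -> nhom H g <= nhom H g'.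
Proof.
move=> gg'; apply: (@leq_card_inj_in _ _ id) => // f /is_homP h.
by apply/is_homP => x y /h/gg'.
Qed.

Lemma tree_hom_lower (T : sgraph) (V : finType) (g : rel V) :
  is_tree T -> symmetric g ->
  narcs g ^ #|edges T| * #|V| ^ #|T| <= nhom T g * (4 * #|V| ^ 2) ^ #|edges T|.
Proof.
move=> treeT g_sym; have cardT := tree_edges treeT.
case: (posnP #|V|) => [->|n0]; first by rewrite cardT expnS mul0n muln0.
case: (posnP #|edges T|) => [e0|e0].
  rewrite e0 !expn0 mul1n muln1.
  rewrite -card_ffun /nhom; apply: subset_leq_card; apply/subsetP => f _.
  apply/is_homP => x y xy; exfalso; move: e0 => /eqP; rewrite cards_eq0.
  move=> /eqP/setP/(_ [set x; y]); rewrite inE => /negP; apply.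
  by apply/imsetP; exists (x, y); rewrite ?inE.
have [U [SU degU]] := dense_restriction g_sym n0.
have := tree_hom_lower_mindeg (restrict_sym U g_sym) treeT degU e0.
have : nhom T (restrict g U) <= nhom T g.
  by apply: nhom_sub => x y /and3P[].
have -> : 4 * #|V| * #|V| = 4 * #|V| ^ 2 by ring.
case: #|edges T| e0 => // e _; rewrite !(expnS _ e) !succnK.
set c' := (4 * _) ^ e; set M := nhom T _; set M' := nhom T g => le_M lb.
move: (narcs (restrict g U)) (narcs g) SU lb => S' S SU.
move: (#|V| ^ #|T|) (#|V| ^ 2) (S ^ e) => nT n2 c lb.
(* The factor 2 lost by keeping only half of the arcs is absorbed by a spare factor 4: the minimum
   degree bound uses one power less. *)
apply: leq_trans (_ : 2 * (nT * S' * c) <= _).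
  have -> : S * c * nT = S * (c * nT) by ring.
  have -> : 2 * (nT * S' * c) = 2 * S' * (c * nT) by ring.
  by apply: leq_mul.
apply: leq_trans (leq_mul (leqnn 2) lb) _.
have -> : M' * (4 * n2 * c') = 4 * (M' * n2 * c') by ring.
by rewrite !leq_mul.
Qed.

(** * Auxiliary graphs on arcs and on tree homomorphisms *)

Lemma sum_sqr_leq (I : finType) (a : I -> nat) :
  (\sum_i a i) ^ 2 <= #|I| * \sum_i a i ^ 2.
Proof.
rewrite -(leq_pmul2l (isT : 0 < 2)) expnS expn1 big_distrl /= big_distrr /=.
have -> : 2 * (#|I| * \sum_i a i ^ 2) = \sum_i \sum_j (a i ^ 2 + a j ^ 2).
  under [RHS]eq_bigr do rewrite big_split /= sum_nat_const.
  by rewrite big_split /= -big_distrr /= sum_nat_const mul2n addnn.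
apply: leq_sum => i _; rewrite !big_distrr /=; apply: leq_sum => j _.
exact: nat_Cauchy.
Qed.

Lemma leq_card_surj (aT rT : finType) (f : aT -> rT) (A : {pred aT})
    (B : {pred rT}) :
  (forall y, y \in B -> exists2 x, x \in A & f x = y) -> #|B| <= #|A|.
Proof.
move=> surj; apply: leq_trans (leq_imset_card f A).
by apply/subset_leq_card/subsetP => y /surj[x Ax <-]; apply: imset_f.
Qed.

Definition sub_rel (V : finType) (P : pred V) (r : rel V) : rel {x | P x} :=
  fun u v => r (val u) (val v).

Lemma narcs_sub_rel (V : finType) (P : pred V) (r : rel V) :
  narcs (sub_rel (P := P) r) =
  #|[pred p : V * V | [&& P p.1, P p.2 & r p.1 p.2]]|.
Proof.
pose f (p : {x | P x} * {x | P x}) := (val p.1, val p.2).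
apply/eqP; rewrite eqn_leq; apply/andP; split.
  apply: (@leq_card_inj_in _ _ f) => [[a b] [c d] _ _ [] | [a b]].
    by move=> /val_inj-> /val_inj->.
  by rewrite !inE /= => ab; rewrite (valP a) (valP b).
apply: (@leq_card_surj _ _ f) => [[a b]] /= /and3P[/= Pa Pb ab].
by exists (exist _ a Pa, exist _ b Pb).
Qed.

Definition arc_rel (V : finType) (g : rel V) :
    rel {p : V * V | g p.1 p.2} :=
  sub_rel (fun p q => g p.1 q.1 && g p.2 q.2).

Arguments arc_rel {V} g _ _.

Lemma card_arc_rel (V : finType) (g : rel V) :
  #|{: {p : V * V | g p.1 p.2}}| = narcs g.
Proof. by rewrite card_sig. Qed.

(* The arcs of [arc_rel g] are the homomorphic 4-cycles of [g]. *)
Lemma narcs_arc_rel (V : finType) (g : rel V) : symmetric g ->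
  narcs g ^ 4 <= narcs (arc_rel g) * #|V| ^ 4.
Proof.
move=> g_sym; set n := #|V|.
(* Cauchy-Schwarz is applied twice: to the degrees, whose squares sum to the codegrees, then to the
   codegrees over the [n ^ 2] pairs. Two common neighbours [c], [d] of [(a, b)] form a 4-cycle, read
   as the adjacent arcs [(a, c)] and [(d, b)]. *)
pose codeg (q : V * V) := \sum_y g q.1 y * g y q.2.
have sum_codeg : \sum_y deg g y ^ 2 = \sum_q codeg q.
  rewrite -(pair_bigA _ (fun x z => codeg (x, z))) /codeg /=.
  under [RHS]eq_bigr do rewrite exchange_big /=.
  rewrite exchange_big /=; apply: eq_bigr => y _.
  under eq_bigr do rewrite -big_distrr /= g_sym.
  by rewrite -big_distrl /= sum_nat_bool expnS expn1.
have sum_codeg2 : \sum_q codeg q ^ 2 <= narcs (arc_rel g).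
  have -> : \sum_q codeg q ^ 2 =
      #|[pred q : (V * V) * (V * V) |
         [&& g q.1.1 q.2.1, g q.2.1 q.1.2, g q.1.1 q.2.2 & g q.2.2 q.1.2]]|.
    rewrite -sum_nat_bool.
    rewrite -(pair_bigA _ (fun a b => [&& g a.1 b.1, g b.1 a.2,
       g a.1 b.2 & g b.2 a.2] : nat)) /=; apply: eq_bigr => q _.
    rewrite -(pair_bigA _ (fun c d => [&& g q.1 c, g c q.2,
       g q.1 d & g d q.2] : nat)) /= expnS expn1 big_distrl /=.
    apply: eq_bigr => y _; rewrite big_distrr; apply: eq_bigr => x _ /=.
    by rewrite !mulnb -andbA.
  rewrite narcs_sub_rel.
  apply: (@leq_card_inj_in _ _ (fun q => ((q.1.1, q.2.1), (q.2.2, q.1.2)))).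
    by move=> [[a b] [c d]] [[a' b'] [c' d']] _ _ [] -> -> -> ->.
  by move=> [[a b] [c d]]; rewrite !inE /= => /and4P[-> -> -> ->].
have le1 : narcs g ^ 2 <= n * \sum_q codeg q.
  by rewrite narcs_deg -sum_codeg; apply: sum_sqr_leq.
have le2 := sum_sqr_leq codeg; rewrite card_prod -/n in le2.
rewrite -[4]/(2 * 2) !expnM.
apply: leq_trans (_ : (n * \sum_q codeg q) ^ 2 <= _); first by rewrite leq_exp2r.
rewrite expnMn (leq_trans (leq_mul (leqnn _) le2)) //.
have -> : (n ^ 2) ^ 2 = n ^ 2 * (n * n) by ring.
by rewrite mulnA mulnC leq_mul.
Qed.

Definition hom_rel (T : sgraph) (V : finType) (g : rel V) :
    rel {f : {ffun T -> V} | is_hom g f} :=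
  sub_rel (fun f f' : {ffun T -> V} => [forall t, g (f t) (f' t)]).

Arguments hom_rel T {V} g _ _.

Lemma card_hom_rel (T : sgraph) (V : finType) (g : rel V) :
  #|{: {f : {ffun T -> V} | is_hom g f}}| = nhom T g.
Proof. by rewrite card_sig. Qed.

Lemma hom_rel_sym (T : sgraph) (V : finType) (g : rel V) :
  symmetric g -> symmetric (hom_rel T g).
Proof. by move=> g_sym f f'; apply: eq_forallb => t; apply: g_sym. Qed.

(** The two coordinates of a homomorphism to [arc_rel g] are pointwise adjacent homomorphisms to
    [g]; both sides describe maps from the product of [T] and [K2]. *)
Lemma nhom_arc_rel (T : sgraph) (V : finType) (g : rel V) :
  nhom T (arc_rel g) <= narcs (hom_rel T g).
Proof.
rewrite narcs_sub_rel.
pose F (f : {ffun T -> {p : V * V | g p.1 p.2}}) :=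
  ([ffun t => (val (f t)).1] : {ffun T -> V},
   [ffun t => (val (f t)).2] : {ffun T -> V}).
apply: (@leq_card_inj_in _ _ F) => [f f' _ _ [/ffunP e1 /ffunP e2] | f /is_homP h].
  apply/ffunP => t; apply: val_inj; move: (e1 t) (e2 t); rewrite !ffunE.
  by rewrite /=; case: (sval _) => [? ?]; case: (sval _) => [? ?] /= -> ->.
rewrite inE /=; apply/and3P; split.
- by apply/is_homP => x y /h/andP[]; rewrite !ffunE.
- by apply/is_homP => x y /h/andP[]; rewrite !ffunE.
- by apply/forallP => t; rewrite !ffunE; apply: (valP (f t)).
Qed.

Lemma nhom_hom_rel (T H : sgraph) (V : finType) (g : rel V) :
  nhom H (hom_rel T g) <= nhom (cart_prod T H) g.
Proof.
pose F (f : {ffun H -> {f : {ffun T -> V} | is_hom g f}}) :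
  {ffun cart_prod T H -> V} := [ffun p : T * H => val (f p.2) p.1].
apply: (@leq_card_inj_in _ _ F) => [f f' _ _ /ffunP e | f /is_homP h].
  apply/ffunP => v; apply/val_inj/ffunP => t.
  by have := e (t, v); rewrite !ffunE.
apply/is_homP => [[t v] [t' v']] /=; rewrite !ffunE /=.
case/orP=> /= /andP[+ /eqP <-]; first by move/is_homP: (valP (f v)); apply.
by move/h/forallP; apply.
Qed.

(** * Sidorenko's inequality for targets with loops *)

Section DoubleCover.

Variables (W : finType) (r : rel W).
Hypothesis r_sym : symmetric r.

Definition double_adj : rel (W * bool) := fun u v => r u.1 v.1 && (u.2 != v.2).

Lemma double_sym : symmetric double_adj.
Proof. by move=> u v; rewrite /double_adj r_sym eq_sym. Qed.

Lemma double_irrefl : irreflexive double_adj.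
Proof. by move=> u; rewrite /double_adj eqxx andbF. Qed.

Definition double_cover := SGraph double_sym double_irrefl.

Lemma narcs_double : narcs double_adj = 2 * narcs r.
Proof.
rewrite mulnC -card_bool /narcs -cardX.
pose F (p : (W * bool) * (W * bool)) := ((p.1.1, p.2.1), p.1.2).
apply/eqP; rewrite eqn_leq; apply/andP; split.
  apply: (@leq_card_inj_in _ _ F) => [[[a b] [c d]] [[a' b'] [c' d']] | p].
    rewrite !inE /double_adj /= => /andP[_ nb] /andP[_ nb'] [-> -> eb].
    by move: nb nb'; rewrite eb; case: b' {eb}; case: d; case: d'.
  by rewrite !inE => /andP[-> _].
apply: (@leq_card_surj _ _ F) => [[[a c] b]]; rewrite !inE /= andbT => ac.
by exists ((a, b), (c, ~~ b)); rewrite // inE /double_adj /= ac; case: b.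
Qed.

Lemma nhom_double (H : sgraph) : nhom H double_adj <= nhom H r * 2 ^ #|H|.
Proof.
rewrite -card_bool -card_ffun /nhom -cardX.
pose F (f : {ffun H -> W * bool}) :=
  ([ffun v => (f v).1] : {ffun H -> W}, [ffun v => (f v).2] : {ffun H -> bool}).
apply: (@leq_card_inj_in _ _ F) => [f f' _ _ [/ffunP e1 /ffunP e2] | f /is_homP h].
  apply/ffunP => v; move: (e1 v) (e2 v); rewrite !ffunE.
  by case: (f v) => [? ?]; case: (f' v) => [? ?] /= -> ->.
rewrite inE /= andbT; apply/is_homP => x y /h /andP[]; by rewrite !ffunE.
Qed.

(** The double cover is loopless, so the hypothesis applies to it. It has half the arc density,
    whence the factor [2 ^ #|edges H|]; the factors [2 ^ #|H|] from lifting maps and from doubling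
    the vertices cancel. *)
Lemma sidorenko_loops (H : sgraph) : sidorenko H -> 0 < #|W| ->
  narcs r ^ #|edges H| * #|W| ^ #|H| <=
  nhom H r * 2 ^ #|edges H| * #|W| ^ (2 * #|edges H|).
Proof.
move=> [_ sidH] W0; have cardD : #|double_cover| = 2 * #|W|.
  by rewrite card_prod card_bool mulnC.
have D0 : 0 < #|double_cover| by rewrite cardD muln_gt0.
have := sidH _ D0; rewrite hom_density_ineqP //.
rewrite cardD -[narcs _]/(narcs double_adj) narcs_double.
move=> /leq_trans/(_ (leq_mul (nhom_double H) (leqnn _))).
set e := #|edges H|; set h := #|H|; set M := #|W|; set X := nhom H r.
rewrite mulnC !expnM !expnMn mulnC.
have p0 k : 0 < 2 ^ k by rewrite expn_gt0.
move: (2 ^ e) (2 ^ h) (p0 e) (p0 h) => a b a0 b0.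
move: (narcs r ^ e) (M ^ h) (M ^ e) X => c u v X'.
have -> : a * c * (b * u) = (a * b) * (c * u) by ring.
have -> : X' * b * (a * a * (v * v)) = (a * b) * (X' * a * (v * v)) by ring.
by rewrite leq_pmul2l // muln_gt0 a0.
Qed.

End DoubleCover.

(** * The bound for nearly regular targets *)

(** Sidorenko's inequality in [hom_rel T g] reads [E ^ eH * M ^ h <= X * 2 ^ eH * M ^ (2 * eH)]. The
    tree lower bounds serve the left side; near-regularity bounds the power of [M] on the right. *)
Lemma nearly_regular_bound (T H : sgraph) (V : finType) (g : rel V) (D L : nat) :
  is_tree T -> sidorenko H -> symmetric g -> 0 < narcs g ->
  (forall x, deg g x <= D) -> #|V| * D <= L * narcs g ->
  let N := #|edges (cart_prod T H)| in
  narcs g ^ N * #|V| ^ (#|T| * #|H|) <=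
  nhom (cart_prod T H) g *
    (2 ^ #|edges H| * 4 ^ (#|edges T| * (#|H| + #|edges H|)) *
     L ^ (2 * #|edges T| * #|edges H|)) * #|V| ^ (2 * N).
Proof.
move=> treeT sidH g_sym S0 degD nD /=.
have cardT := tree_edges treeT; rewrite card_edges_cart.
have lower := tree_hom_lower treeT g_sym.
have upper := tree_hom_upper g_sym treeT degD.
have arc_sym : symmetric (arc_rel g).
  by move=> p q; rewrite /arc_rel /sub_rel g_sym (g_sym (val p).2).
have lowerE := tree_hom_lower treeT arc_sym.
have c4 := narcs_arc_rel g_sym.
rewrite card_arc_rel in lowerE.
have leE := nhom_arc_rel T g.
have leX := nhom_hom_rel T H g.
have n0 : 0 < #|V|.
  by move: S0 => /card_gt0P[[x _] _]; apply/card_gt0P; exists x.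
have M0 : 0 < nhom T g.
  have : 0 < narcs g ^ #|edges T| * #|V| ^ #|T| by rewrite muln_gt0 !expn_gt0 S0 n0.
  by move=> /leq_trans/(_ lower); rewrite muln_gt0 => /andP[].
have := sidorenko_loops (hom_rel_sym (T := T) g_sym) sidH.
rewrite card_hom_rel => /(_ M0) sid.
move: leE leX sid lowerE c4 lower upper nD S0 n0 M0; rewrite cardT.
set n := #|V|; set S := narcs g; set e := #|edges T|; set h := #|H|.
set eH := #|edges H|; set M := nhom T g; set X := nhom (cart_prod T H) g.
move: (nhom T _) (nhom H _) (narcs (arc_rel g)) (narcs _) => E' X' F E.
clearbody n S e h eH M X.
move=> leE leX sid lowerE c4 lower upper nD S0 n0 M0.
have upper' : M * n ^ (2 * e) <= (L * S) ^ e * n ^ e.+1.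
  have -> : M * n ^ (2 * e) = n ^ e * (n ^ e * M) by rewrite mul2n -addnn expnD; ring.
  rewrite (leq_trans (leq_mul (leqnn _) upper)) // mulnA -expnMn.
  by rewrite leq_mul // leq_exp.
(* The tree bound is applied in [arc_rel g], which has [S] vertices and at least [S ^ 4 / n ^ 4]
   arcs. *)
have lowE : S ^ (3 * e).+1 <= E * 4 ^ e * n ^ (4 * e).
  have : (S ^ 4) ^ e <= (F * n ^ 4) ^ e by apply: leq_exp.
  rewrite [X in _ <= X]expnMn -[(n ^ 4) ^ e]expnM => c4e.
  rewrite -(@leq_pmul2l (S ^ e.*2)) ?expn_gt0 ?S0 //.
  have -> : S ^ e.*2 * S ^ (3 * e).+1 = (S ^ 4) ^ e * S ^ e.+1.
    by rewrite -expnM -!expnD; congr (_ ^ _); lia.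
  apply: leq_trans (leq_mul c4e (leqnn _)) _.
  rewrite mulnAC (leq_trans (leq_mul lowerE (leqnn _))) //.
  rewrite expnMn -expnM -mul2n.
  have -> : S ^ (2 * e) * (E * 4 ^ e * n ^ (4 * e)) =
    E * (4 ^ e * S ^ (2 * e)) * n ^ (4 * e).
    by move: (4 ^ e) (S ^ _) (n ^ _) => a b c; ring.
  by rewrite !leq_mul.
(* This is the power of [S] that [upper'] introduces when raised to [2 * eH]. *)
rewrite -(@leq_pmul2l (S ^ (2 * e * eH))) ?expn_gt0 ?S0 //.
have lowh := leq_exp h lower; have lowEh := leq_exp eH lowE.
have uph := leq_exp (2 * eH) upper'.
apply: leq_trans (_ : (S ^ e * n ^ e.+1) ^ h * (S ^ (3 * e).+1) ^ eH <= _).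
  rewrite expnMn -!expnM mulnA -expnD.
  have -> : (S ^ (e * h) * n ^ (e.+1 * h)) * S ^ ((3 * e).+1 * eH) =
    S ^ (e * h) * S ^ ((3 * e).+1 * eH) * n ^ (e.+1 * h) by ring.
  rewrite -expnD leq_mul // eq_leq //; congr (_ ^ _); lia.
apply: leq_trans (leq_mul lowh lowEh) _.
have -> : (M * (4 * n ^ 2) ^ e) ^ h * (E * 4 ^ e * n ^ (4 * e)) ^ eH =
  (E ^ eH * M ^ h) * (4 ^ (e * (h + eH)) * n ^ (2 * e * h) * n ^ (4 * e * eH)).
  have -> : 2 * e * h = e * h + e * h by lia.
  rewrite !expnMn -!expnM mulnDr !expnD.
  by move: (4 ^ _) (4 ^ _) (n ^ _) (n ^ _) => a b u v; ring.
apply: leq_trans (leq_mul sid (leqnn _)) _.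
apply: leq_trans (_ : X * (2 ^ eH * 4 ^ (e * (h + eH)) * n ^ (2 * e * h)) *
   (M * n ^ (2 * e)) ^ (2 * eH) <= _).
  rewrite expnMn -[(n ^ _) ^ _]expnM [2 * e * (2 * eH)](_ : _ = 4 * e * eH); last lia.
  have -> : X' * 2 ^ eH * M ^ (2 * eH) *
    (4 ^ (e * (h + eH)) * n ^ (2 * e * h) * n ^ (4 * e * eH)) =
    X' * (2 ^ eH * 4 ^ (e * (h + eH)) * n ^ (2 * e * h) *
      (M ^ (2 * eH) * n ^ (4 * e * eH))).
    by move: (4 ^ _) (2 ^ _) (M ^ _) (n ^ _) (n ^ _) => a b u v w; ring.
  by rewrite -[leqRHS]mulnA leq_mul.
apply: leq_trans (leq_mul (leqnn _) uph) _.
rewrite !expnMn -!expnM eq_leq //.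
have -> : n ^ (2 * (e * h + e.+1 * eH)) = n ^ (2 * e * h) * n ^ (e.+1 * (2 * eH)).
  by rewrite -expnD; congr (_ ^ _); lia.
have -> : e * (2 * eH) = 2 * e * eH by lia.
move: (4 ^ _) (2 ^ _) (L ^ _) (S ^ _) (n ^ _) (n ^ _) => a b u v w w'; ring.
Qed.

(** * Tensor powers absorb polynomial losses *)

Lemma poly_lt_exp2 (c q j : nat) : exists l, c * (q * l).+1 ^ j < 2 ^ l.
Proof.
(* For [l = 2 ^ s] the left side is below 2 to the power [c + (q + s) * j], linear in [s]; taking
   [s = 2 t] makes [2 ^ s] exceed [t ^ 2], which suffices. *)
pose t := c + q * j + 2 * j; pose s := t + t; exists (2 ^ s).
have le_s : c + (q + s) * j <= 2 ^ s.
  rewrite /s expnD; have lt_t : t < 2 ^ t by apply: ltn_expl.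
  apply: leq_trans (leq_mul lt_t lt_t); rewrite /t; nia.
apply: leq_trans (leq_pexp2l (isT : 0 < 2) le_s); rewrite expnD expnM.
have lt_q : (q * 2 ^ s).+1 <= 2 ^ (q + s).
  rewrite expnD; have : q < 2 ^ q by apply: ltn_expl.
  have : 0 < 2 ^ s by rewrite expn_gt0.
  by move: (2 ^ q) (2 ^ s) => a b; nia.
have le_j : (q * 2 ^ s).+1 ^ j <= (2 ^ (q + s)) ^ j.
  exact: leq_exp.
have lt_c : c < 2 ^ c by apply: ltn_expl.
have : 0 < (2 ^ (q + s)) ^ j by rewrite !expn_gt0.
by move: lt_c le_j; move: (2 ^ c) (_ ^ j) (_ ^ j) => a u v; nia.
Qed.

(** Bernoulli's inequality for [(1 + 1/a) ^ k], multiplied by [a ^ (k + 1)]. *)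
Lemma bernoulli_nat (a k : nat) : a ^ k * (a + k) <= a * a.+1 ^ k.
Proof.
elim: k => [|k IH]; first by rewrite addn0 mulnC.
rewrite !expnS; move: IH; move: (a ^ k) (a.+1 ^ k) => u v; nia.
Qed.

(** If [a < b] with [a] positive, Bernoulli gives [2 * a ^ a <= b ^ a]; along [k = a * l] the ratio
    grows at least like [2 ^ l] and overtakes any polynomial. *)
Lemma leq_of_exp_poly (a b c q j : nat) :
  (forall k, b ^ k <= a ^ k * (c * (q * k).+1 ^ j)) -> b <= a.
Proof.
move=> hk; rewrite leqNgt; apply/negP => lt_ab.
have [a0|a_gt0] := posnP a.
  by have := hk 1; rewrite a0 !expn1 mul0n leqn0 => /eqP b0; rewrite b0 in lt_ab.
have two : 2 * a ^ a <= b ^ a.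
  apply: leq_trans (_ : a.+1 ^ a <= _); last by rewrite leq_exp2r.
  rewrite -(leq_pmul2l a_gt0); apply: leq_trans (bernoulli_nat a a).
  by rewrite addnn -mul2n mulnCA mulnA mulnC mulnA.
have [l] := poly_lt_exp2 c (q * a) j; apply/negP; rewrite -leqNgt.
rewrite -(@leq_pmul2l (a ^ (a * l))) ?expn_gt0 ?a_gt0 //.
rewrite -(mulnA q) (leq_trans _ (hk _)) // !expnM -expnMn mulnC.
exact: leq_exp.
Qed.

Section TensorPower.

Variables (V : finType) (g : rel V) (k : nat).

Definition tensor : rel {ffun 'I_k -> V} := fun f f' => [forall i, g (f i) (f' i)].

Lemma tensor_sym : symmetric g -> symmetric tensor.
Proof. by move=> g_sym f f'; apply: eq_forallb => i; apply: g_sym. Qed.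

Lemma narcs_tensor : narcs g ^ k <= narcs tensor.
Proof.
rewrite /narcs -[X in _ ^ X](card_ord k) -card_ffun_on.
pose F (f : {ffun 'I_k -> V * V}) :=
  ([ffun i => (f i).1] : {ffun 'I_k -> V}, [ffun i => (f i).2] : {ffun 'I_k -> V}).
apply: (@leq_card_inj_in _ _ F) => [f f' _ _ [/ffunP e1 /ffunP e2] | f /ffun_onP h].
  apply/ffunP => i; move: (e1 i) (e2 i); rewrite !ffunE.
  by case: (f i) => [? ?]; case: (f' i) => [? ?] /= -> ->.
by rewrite inE /=; apply/forallP => i; rewrite !ffunE; apply: h.
Qed.

Lemma nhom_tensor (K : sgraph) : nhom K tensor <= nhom K g ^ k.
Proof.
rewrite /nhom -[X in _ ^ X](card_ord k) -card_ffun_on.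
pose F (f : {ffun K -> {ffun 'I_k -> V}}) : {ffun 'I_k -> {ffun K -> V}} :=
  [ffun i => [ffun x => f x i]].
apply: (@leq_card_inj_in _ _ F) => [f f' _ _ /ffunP e | f /is_homP h].
  apply/ffunP => x; apply/ffunP => i.
  by have /ffunP/(_ x) := e i; rewrite !ffunE.
apply/ffun_onP => i; apply/is_homP => x y /h/forallP/(_ i).
by rewrite !ffunE.
Qed.

End TensorPower.

(** * Dyadic degree classes and the nearly regular graph between two of them *)

Section DegreeClasses.

Variables (V : finType) (g : rel V) (r : nat).
Hypothesis g_sym : symmetric g.
Hypothesis card_le : #|V| <= 2 ^ r.

Definition dclass (x : V) : 'I_r.+1 := inord (trunc_log 2 (deg g x)).

(** As [trunc_log] sends 0 to 0, positivity is what keeps isolated vertices out of class 0. *)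
Definition in_dclass (i : 'I_r.+1) : pred V :=
  fun x => (0 < deg g x) && (dclass x == i).

Definition class_arcs (i j : 'I_r.+1) : pred (V * V) :=
  fun p => [&& in_dclass i p.1, in_dclass j p.2 & g p.1 p.2].

Lemma in_dclass_deg i x : in_dclass i x -> 2 ^ i <= deg g x <= 2 ^ i.+1.
Proof.
case/andP=> x0 /eqP <-; have /andP[lo hi] := trunc_log_bounds (isT : 1 < 2) x0.
have le_r : trunc_log 2 (deg g x) < r.+1.
  rewrite ltnS -[leqRHS](@trunc_expnK 2) //; apply: leq_trunc_log.
  by apply: leq_trans card_le; apply: max_card.
by rewrite /dclass inordK // lo ltnW.
Qed.

Lemma card_in_dclass i : #|in_dclass i| * 2 ^ i <= narcs g.
Proof.
rewrite narcs_deg -sum_nat_const [leqRHS](bigID (in_dclass i)) /=.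
apply: leq_trans (leq_addr _ _); apply: leq_sum => x.
by case/in_dclass_deg/andP.
Qed.

(** Pigeonhole over the [r.+1 ^ 2] ordered pairs of classes. *)
Lemma popular_class :
  exists i j, narcs g <= r.+1 ^ 2 * #|class_arcs i j|.
Proof.
pose m (q : 'I_r.+1 * 'I_r.+1) := #|class_arcs q.1 q.2|.
have [[i j] _ mmax] := @arg_maxnP _ (ord0, ord0) predT m isT.
exists i, j; rewrite /narcs -sum1_card.
rewrite (partition_big (fun p : V * V => (dclass p.1, dclass p.2)) predT) //=.
rewrite -[r.+1 in leqRHS]card_ord -[_ ^ 2]/(_ * _) -card_prod -sum_nat_const.
apply: leq_sum => q _; apply: leq_trans (mmax q isT); rewrite sum1_card.
apply/subset_leq_card/subsetP => [[x y]]; rewrite !unfold_in /=.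
case/andP=> xy /eqP <-; rewrite /class_arcs /in_dclass /= !eqxx !andbT xy andbT.
by rewrite (@deg_gt0 _ g x y) // (@deg_gt0 _ g y x) // g_sym.
Qed.

Variables i j : 'I_r.+1.

Definition class_rel :
    rel {p : V * V | in_dclass i p.1 && in_dclass j p.2} :=
  sub_rel (fun p q => g p.1 q.2 && g q.1 p.2).

Lemma class_rel_sym : symmetric class_rel.
Proof. by move=> p q; rewrite /class_rel /sub_rel andbC. Qed.

(** Arcs [(a, b)] and [(c, d)] between the classes make [(a, d)] adjacent to [(c, b)]. *)
Lemma narcs_class_rel : #|class_arcs i j| ^ 2 <= narcs class_rel.
Proof.
rewrite narcs_sub_rel -[_ ^ 2]/(_ * _) -cardX.
apply: (@leq_card_inj_in _ _ (fun q => ((q.1.1, q.2.2), (q.2.1, q.1.2)))).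
  by move=> [[a b] [c d]] [[a' b'] [c' d']] _ _ [] -> -> -> ->.
move=> [[a b] [c d]]; rewrite !inE /= => /andP[/and3P[/= -> -> ->]].
by move=> /and3P[/= -> -> ->].
Qed.

Lemma card_class_rel :
  #|{: {p : V * V | in_dclass i p.1 && in_dclass j p.2}}| =
  #|in_dclass i| * #|in_dclass j|.
Proof. by rewrite card_sig -cardX; apply: eq_card => p; rewrite !inE. Qed.

(** A neighbour of [(x, y)] pairs a neighbour of [y] with a neighbour of [x]. *)
Lemma deg_class_rel p : deg class_rel p <= 2 ^ i.+1 * 2 ^ j.+1.
Proof.
case: p => [[x y] /= pxy]; have /andP[xi yj] := pxy.
have /andP[_ lex] := in_dclass_deg xi; have /andP[_ ley] := in_dclass_deg yj.
apply: leq_trans (leq_mul lex ley); rewrite /deg -cardX.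
apply: (@leq_card_inj_in _ _ (fun q => ((val q).2, (val q).1))).
  move=> q q' _ _ [e2 e1]; apply: val_inj; move: e1 e2 => /=.
  by case: (sval q) => ? ?; case: (sval q') => ? ? /= -> ->.
move=> q; rewrite !inE /= => /andP[/= xq yq].
by apply/andP; split; rewrite // -topredE /= g_sym.
Qed.

(* Along a proper 2-colouring [col] of [K], a homomorphism to [class_rel] is a
   pair of homomorphisms to [g], one using the first coordinate on the class
   [col] and the second one on its complement, the other one the converse. *)
Lemma nhom_class_rel (K : sgraph) : bipartite K ->
  nhom K class_rel <= nhom K g ^ 2.
Proof.
case=> col hcol; rewrite -[_ ^ 2]/(_ * _) /nhom -cardX.
pose F (f : {ffun K -> {p : V * V | in_dclass i p.1 && in_dclass j p.2}}) :=
  ([ffun v => if col v then (val (f v)).1 else (val (f v)).2] : {ffun K -> V},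
   [ffun v => if col v then (val (f v)).2 else (val (f v)).1] : {ffun K -> V}).
apply: (@leq_card_inj_in _ _ F) => [f f' _ _ [/ffunP e1 /ffunP e2] | f /is_homP h].
  apply/ffunP => v; apply: val_inj; move: (e1 v) (e2 v); rewrite !ffunE /=.
  by case: (sval (f v)) => ? ?; case: (sval (f' v)) => ? ?; case: (col v) => /= -> ->.
rewrite inE /=; apply/andP; split; apply/is_homP => x y xy; rewrite !ffunE;
  have := hcol x y xy; have := h x y xy => /andP[/= gxy gyx];
  by case: (col x); case: (col y) => //= _; rewrite // g_sym.
Qed.

End DegreeClasses.

Arguments class_rel {V} g {r} i j _ _.

(** * From nearly regular targets to all targets *)

(** [L] bounds the ratio of maximum to average degree; a loss polynomial in [L] is what the tensor
    power argument tolerates. *)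
Definition nearly_regular_sidorenko (K : sgraph) (c m : nat) :=
  forall (V : finType) (g : rel V) (D L : nat),
    symmetric g -> 0 < narcs g -> (forall x, deg g x <= D) ->
    #|V| * D <= L * narcs g ->
    narcs g ^ #|edges K| * #|V| ^ #|K| <=
    nhom K g * (c * L ^ m) * #|V| ^ (2 * #|edges K|).

Lemma nearly_regular_reduction (K : sgraph) (c m r : nat) (V : finType)
    (g : rel V) :
  bipartite K -> nearly_regular_sidorenko K c m -> #|K| <= 2 * #|edges K| ->
  symmetric g -> 0 < narcs g -> #|V| <= 2 ^ r ->
  narcs g ^ (2 * #|edges K|) <=
  nhom K g ^ 2 * (#|V| ^ 2) ^ (2 * #|edges K| - #|K|) *
    (c * 4 ^ m * r.+1 ^ (4 * m + 4 * #|edges K|)).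
Proof.
move=> bipK nrK leK g_sym S0 leV.
have [i [j le_S]] := popular_class r g_sym.
have leA := card_in_dclass g leV i; have leB := card_in_dclass g leV j.
have m2 := narcs_class_rel g i j.
have hom2 := nhom_class_rel g_sym i j bipK.
have arc0 : 0 < #|class_arcs g i j|.
  by move: (leq_trans S0 le_S); rewrite muln_gt0 => /andP[].
have S2 : 0 < narcs (class_rel g i j).
  by apply: leq_trans m2; rewrite expn_gt0 arc0.
(* The class sizes are at most [S / 2 ^ i] and [S / 2 ^ j], so vertices times maximum degree is at
   most [4 * S ^ 2], and [S] is at most [r.+1 ^ 2] times the number of class arcs: hence this
   [L]. *)
have := nrK _ _ _ (4 * r.+1 ^ 4) (@class_rel_sym _ g r i j) S2
  (@deg_class_rel _ g r g_sym leV i j).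
rewrite card_class_rel.
have n2 : #|in_dclass g i| * #|in_dclass g j| <= #|V| ^ 2.
  by rewrite -[_ ^ 2]/(_ * _); apply: leq_mul; apply: max_card.
have n0 : 0 < #|in_dclass g i| * #|in_dclass g j|.
  case/card_gt0P: arc0 => [[x y]] /and3P[/= xi yj _].
  by rewrite muln_gt0; apply/andP; split; apply/card_gt0P; [exists x | exists y].
move: leK n0 n2 leA leB m2 hom2 S2 le_S arc0.
move: (nhom K (class_rel g i j)) (narcs (class_rel g i j)) => X2 S2.
move: #|class_arcs g i j| #|in_dclass g i| #|in_dclass g j| => a A B.
move: (nat_of_ord i) (nat_of_ord j) => {}i {}j.
move: r.+1 #|edges K| #|K| (nhom K g) (narcs g) #|V| => R N h X S n.
move=> {}leK n0 n2 leA leB m2 hom2 S20 le_S a0 nr.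
have {nr} : S2 ^ N * (A * B) ^ h <= X2 * (c * (4 * R ^ 4) ^ m) * (A * B) ^ (2 * N).
  apply: nr.
  have := leq_mul (leq_trans leA le_S) (leq_trans leB le_S).
  rewrite !(expnS 2); move: (2 ^ i) (2 ^ j) => u v leAB.
  apply: leq_trans (_ : 4 * R ^ 4 * a ^ 2 <= _); last by rewrite leq_mul.
  apply: leq_trans (_ : 4 * ((A * u) * (B * v)) <= _).
    by apply: eq_leq; ring.
  apply: leq_trans (leq_mul (leqnn 4) leAB) _; apply: eq_leq; ring.
(* Cancelling leaves [A * B] with the exponent [2 * N - h] on the right only, so that it can be
   replaced by its upper bound [n ^ 2]. *)
rewrite -[in (A * B) ^ (2 * N)](subnK leK) expnD mulnA.
rewrite leq_pmul2r ?expn_gt0 ?n0 // => nr.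
apply: leq_trans (leq_exp (2 * N) le_S) _; rewrite expnMn -expnM.
apply: leq_trans (_ : R ^ (2 * (2 * N)) * S2 ^ N <= _).
  by rewrite leq_mul // expnM leq_exp.
apply: leq_trans (leq_mul (leqnn _) nr) _.
apply: leq_trans (_ : R ^ (2 * (2 * N)) *
   (X ^ 2 * (c * (4 * R ^ 4) ^ m) * (n ^ 2) ^ (2 * N - h)) <= _).
  by rewrite leq_mul // leq_mul ?leq_exp // leq_mul.
rewrite expnMn -[(R ^ 4) ^ m]expnM [R ^ (_ + _)]expnD mulnA.
rewrite [2 * (2 * N)](_ : _ = 4 * N); last by lia.
by move: (4 ^ _) (_ ^ (2 * N - h)) => u v; apply: eq_leq; ring.
Qed.

Theorem sidorenko_of_nearly_regular (K : sgraph) (c m : nat) :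
  bipartite K -> nearly_regular_sidorenko K c m -> #|K| <= 2 * #|edges K| ->
  sidorenko K.
Proof.
move=> bipK nrK leK; split=> // G G0; rewrite hom_density_ineqP //.
set N := #|edges K| in leK *; set n := #|G| in G0 *; set g := @adj G.
have [N0|N0] := posnP N.
  have K0 : #|K| = 0 by apply/eqP; rewrite -leqn0 (leq_trans leK) // N0.
  rewrite N0 K0 !muln1; case/card_gt0P: G0 => v _.
  apply/card_gt0P; exists [ffun=> v]; apply/is_homP => x.
  by have := fintype0 x; rewrite K0 => /(_ erefl).
have [->|S0] := posnP (narcs g); first by rewrite exp0n.
(* This is the goal squared, with [n ^ #|K|] cancelled, in the shape of
   [nearly_regular_reduction]. *)
suff le : narcs g ^ (2 * N) <= nhom K g ^ 2 * (n ^ 2) ^ (2 * N - #|K|).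
  rewrite -[X in _ <= _ * _ ^ X](subnK leK) expnD mulnA leq_mul //.
  rewrite -(@leq_exp2r _ _ 2) // expnMn -!expnM [N * 2]mulnC.
  by rewrite [(_ - _) * 2]mulnC [n ^ (2 * _)]expnM.
apply: (@leq_of_exp_poly _ _ (c * 4 ^ m) n (4 * m + 4 * N)) => k.
have Sk : 0 < narcs (tensor g (k := k)).
  by apply: leq_trans (narcs_tensor g k); rewrite expn_gt0 S0.
(* The crude bound [n <= 2 ^ n] makes [r = n * k] linear in [k], hence the loss polynomial in
   [k]. *)
have le_n : #|{ffun 'I_k -> G}| <= 2 ^ (n * k).
  by rewrite card_ffun card_ord expnM leq_exp // ltnW // ltn_expl.
have := nearly_regular_reduction bipK nrK leK (tensor_sym (@adj_sym G)) Sk le_n.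
rewrite -/N card_ffun card_ord -/n -[@adj G]/g => le.
rewrite -expnM mulnC expnM (leq_trans (leq_exp _ (narcs_tensor g k))) //.
apply: leq_trans le _; rewrite leq_mul // expnMn leq_mul //.
  by rewrite -expnM mulnC expnM leq_exp // nhom_tensor.
by rewrite -!expnM eq_leq //; congr (_ ^ _); lia.
Qed.

(** * Cartesian products with a tree *)

Lemma bipartite_cart (H1 H2 : sgraph) :
  bipartite H1 -> bipartite H2 -> bipartite (cart_prod H1 H2).
Proof.
move=> [c1 h1] [c2 h2]; exists (fun p : H1 * H2 => c1 p.1 (+) c2 p.2).
move=> [a b] [a' b'] /orP[] /= /andP[/= + /eqP <-].
  by move/h1; case: (c1 a); case: (c1 a'); case: (c2 b).
by move/h2; case: (c2 b); case: (c2 b'); case: (c1 a).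
Qed.

(** The product is a copy of [H]. This case stands apart because isolated vertices of [H] can
    violate the size condition of [sidorenko_of_nearly_regular]. *)
Lemma sidorenko_cart_point (T H : sgraph) :
  #|T| = 1 -> #|edges T| = 0 -> sidorenko H -> bipartite (cart_prod T H) ->
  sidorenko (cart_prod T H).
Proof.
move=> T1 eT [_ sidH] bip; split=> // G G0; have := sidH G G0.
rewrite !hom_density_ineqP // card_edges_cart card_prod T1 eT !mul1n.
move=> /leq_trans; apply; rewrite leq_mul //.
have [t tT] : exists t : T, all_equal_to t.
  by move/eqP: T1 => /fintype1P.
pose F (f : {ffun H -> G}) : {ffun cart_prod T H -> G} := [ffun p : T * H => f p.2].
apply: (@leq_card_inj_in _ _ F) => [f f' _ _ /ffunP e | f /is_homP h].
  by apply/ffunP => v; have := e (t, v); rewrite !ffunE.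
apply/is_homP => [[a v] [b w]] /=; rewrite !ffunE /=.
by case/orP=> /= /andP[ab _]; [rewrite (tT a) (tT b) adj_irrefl in ab | apply: h].
Qed.

Theorem theorem1p2 (T H : sgraph) (hT : is_tree T) (hH : bipartite H)
    (hS : sidorenko H) : sidorenko (cart_prod T H).
Proof.
have bip := bipartite_cart (tree_bipartite hT) hH.
have cardT := tree_edges hT; have [e0|e0] := posnP #|edges T|.
  by apply: sidorenko_cart_point; rewrite // cardT e0.
apply: sidorenko_of_nearly_regular bip _ _; last first.
  (* As [T] has an edge, [#|T|] is at most twice [#|edges T|], and the copies of edges of [T]
     already suffice. *)
  by rewrite card_edges_cart card_prod cardT; nia.
move=> V g D L g_sym S0 degD nD; rewrite card_prod.
exact: nearly_regular_bound hT hS g_sym S0 degD nD.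
Qed.
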